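(* Let $\kappa>0$ and $r_\kappa=\frac{\pi}{2\sqrt\kappa}$. Let $G=(V,E)$ be a connected undirected graph with $V=\{1,\dots,N\}$, $N\ge 2$, let $(\mathcal{M},d)$ be a complete $CAT(\kappa)$ metric space, and let $X_0=(X_v(0))_{v\in V}\in\mathcal{M}^N$ be an initial configuration such that $\operatorname{diam}(\{X_v(0):v\in V\})<r_\kappa$. Let $X_k=(X_v(k))_{v\in V}$, $k\ge0$, be the sequence generated from $X_0$ by the Random Pairwise Midpoint algorithm (defined in the context). Then there exists a random variable $X_\infty$ taking values in the consensus subspace $\{(x,\dots,x):x\in\mathcal{M}\}\subset\mathcal{M}^N$ such that $X_k$ tends to $X_\infty$ almost surely as $k\to\infty$.
   Context: Graph: $E$ is a set of unordered pairs $\{v,w\}$ of distinct elements of $V$; $v\sim w$ means $\{v,w\}\in E$; $\deg(v)$ is the number of neighbors of $v$. For $S\subset\mathcal{M}$, $\operatorname{diam}(S)=\sup\{d(s,s'):s,s'\in S\}$. $CAT(\kappa)$ space ($\kappa>0$): put $D_\kappa=\pi/\sqrt\kappa=2r_\kappa$ and let $(\mathcal{M}_\kappa^2,\bar d)$ be the unit sphere $\{x\in\mathbb{R}^3:\|x\|=1\}$ with distance $\bar d(x,y)=\kappa^{-1/2}\arccos\langle x,y\rangle$. A geodesic in $(\mathcal{M},d)$ is a map $c:[0,l]\to\mathcal{M}$ with $d(c(t),c(t'))=|t-t'|$ for all $t,t'\in[0,l]$; it joins $c(0)$ to $c(l)$. $(\mathcal{M},d)$ is $CAT(\kappa)$ if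 any two points at distance less than $D_\kappa$ are joined by a geodesic and for every geodesic triangle with vertices $p,q,r$ (three points and three geodesic segments joining them) of perimeter $d(p,q)+d(q,r)+d(r,p)<2D_\kappa$, every point $x$ on the side from $p$ to $q$ and every point $y$ on the side from $p$ to $r$, one has $d(x,y)\le\bar d(\bar x,\bar y)$, where $\bar p,\bar q,\bar r\in\mathcal{M}_\kappa^2$ is a comparison triangle (same pairwise distances as $p,q,r$), $\bar x\in[\bar p,\bar q]$ satisfies $\bar d(\bar p,\bar x)=d(p,x)$, and $\bar y\in[\bar p,\bar r]$ satisfies $\bar d(\bar p,\bar y)=d(p,y)$. In such a space two points $x,y$ with $d(x,y)<D_\kappa$ are joined by a unique geodesic and have a unique midpoint $\left\langle\frac{x+y}{2}\right\rangle$, i.e. a unique point $m$ with $d(x,m)=d(y,m)=d(x,y)/2$; closed balls of radius less than $r_\kappa$ are convex. Random Pairwise Midpoint algorithm: let $(V_k,W_k)_{k\ge 0}$ be i.i.d. random variables with values in $V\times V$ such that $\mathbb{P}[\{V_k,W_k\}=\{v,w\}]=\frac1N\left(\frac1{\deg(v)}+\frac1{\deg(w)}\right)$ if $v\sim w$ and $0$ otherwise, and such that $(V_k,W_k)$ is independent of $X_0,\dots,X_{k-1},(V_0,W_0),\dots,(V_{k-1},W_{k-1})$. The initial configuration $X_0$ is given (deterministic). For each $k\ge1$, set $X_{V_k}(k)=X_{W_k}(k)=\left\langle\frac{X_{V_k}(k-1)+X_{W_k}(k-1)}{2}\right\rangle$ and $X_v(k)=X_v(k-1)$ for $v\notin\{V_k,W_k\}$.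 (Under the diameter condition on $X_0$, all points remain at mutual distance less than $r_\kappa$, so the algorithm is well defined.) *)

(* Defs.v *)
From HB Require Import structures.
From mathcomp Require Import all_boot all_order all_algebra.
From mathcomp Require Import all_classical all_reals all_analysis.

Set Implicit Arguments.
Unset Strict Implicit.
Unset Printing Implicit Defensive.

Import Order.TTheory GRing.Theory Num.Theory.
Import numFieldNormedType.Exports.

Local Open Scope classical_set_scope.
Local Open Scope ring_scope.

#[short(type="completeMetricType")]
HB.structure Definition CompleteMetric (K : numDomainType) :=
  {T of Complete T & Metric K T}.

Definition borel (T : ptopologicalType) := g_sigma_algebraType (@open T).

(* Valued in the extended reals, so that an unbounded set has diameter +oo. *)
Definition diam (R : realType) (T : metricType R) (S : set T) : \bar R :=
  ereal_sup [set (mdist s s')%:E | s in S & s' in S].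

Section Graph.
Variables (N : nat) (E : {set {set 'I_N}}).

Definition simple_graph : Prop := forall e, e \in E -> #|e| = 2%N.

Definition adj : rel 'I_N := fun v w => [set v; w]%SET \in E.

Definition deg (v : 'I_N) : nat := #|[set w | adj v w]%SET|.

Definition connected_graph : Prop := forall v w, connect adj v w.

End Graph.

Section CAT.
Variable R : realType.

Definition geodesic (T : Type) (d : T -> T -> R) (x y : T) (l : R) (c : R -> T) :
    Prop :=
  [/\ 0 <= l,
      forall t t', 0 <= t <= l -> 0 <= t' <= l -> d (c t) (c t') = `|t - t'|,
      c 0 = x & c l = y].

Definition on_segment (T : Type) (d : T -> T -> R) (x y z : T) : Prop :=
  exists l c t, [/\ geodesic d x y l c, 0 <= t <= l & z = c t].

Definition dotp (x y : 'rV[R]_3) : R := \sum_i x ord0 i * y ord0 i.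

(* The library norm on row vectors is the maximum norm, so the Euclidean norm
   is spelled out. *)
Definition sphere2 := {x : 'rV[R]_3 | Num.sqrt (dotp x x) == 1}.

Definition model_dist (kappa : R) (x y : sphere2) : R :=
  (Num.sqrt kappa)^-1 * acos (dotp (val x) (val y)).

Definition D_ (kappa : R) : R := pi / Num.sqrt kappa.

Definition r_ (kappa : R) : R := pi / (2 * Num.sqrt kappa).

Definition comparison_inequality (kappa : R) (M : metricType R) (p q r x y : M) :
    Prop :=
  forall p' q' r' x' y' : sphere2,
    model_dist kappa p' q' = mdist p q ->
    model_dist kappa q' r' = mdist q r ->
    model_dist kappa p' r' = mdist p r ->
    on_segment (model_dist kappa) p' q' x' ->
    model_dist kappa p' x' = mdist p x ->
    on_segment (model_dist kappa) p' r' y' ->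
    model_dist kappa p' y' = mdist p y ->
    mdist x y <= model_dist kappa x' y'.

(* The sides of a triangle are part of its data: geodesics are not assumed
   unique here. *)
Definition CAT (kappa : R) (M : metricType R) : Prop :=
  (forall x y : M, mdist x y < D_ kappa ->
     exists l c, geodesic (@mdist R M) x y l c) /\
  (forall (p q r : M) (lpq lqr lpr : R) (cpq cqr cpr : R -> M),
     geodesic (@mdist R M) p q lpq cpq ->
     geodesic (@mdist R M) q r lqr cqr ->
     geodesic (@mdist R M) p r lpr cpr ->
     mdist p q + mdist q r + mdist r p < 2 * D_ kappa ->
     forall s t, 0 <= s <= lpq -> 0 <= t <= lpr ->
       comparison_inequality kappa p q r (cpq s) (cpr t)).

End CAT.

Section Algorithm.
Variables (R : realType) (M : metricType R).

Definition is_midpoint (x y m : M) : Prop :=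
  mdist x m = mdist x y / 2 /\ mdist y m = mdist x y / 2.

(* The value x is a convention for the case when there is no midpoint; in a
   CAT(kappa) space the midpoint exists and is unique below distance D_ kappa. *)
Definition midpoint (x y : M) : M := xget x [set m | is_midpoint x y m].

(* Configurations in M^N are row vectors, whose library topology is the product
   topology. Step k uses the pair vw k for k >= 1; vw 0 is never used. *)
Fixpoint rpm (N : nat) (X0 : 'rV[M]_N) (vw : nat -> 'I_N * 'I_N) (k : nat) :
    'rV[M]_N :=
  if k is k'.+1 then
    let X := rpm X0 vw k' in
    let v := (vw k).1 in
    let w := (vw k).2 in
    \row_u if (u == v) || (u == w) then midpoint (X ord0 v) (X ord0 w)
           else X ord0 u
  else X0.

Definition consensus (N : nat) : set 'rV[M]_N :=
  [set X | exists x : M, X = const_mx x].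

End Algorithm.

Section RandomPairs.
Context (d : measure_display) (Omega : measurableType d) (R : realType).
Variable P : probability Omega R.

(* An event of the form VW k \in A, for A any set of ordered pairs: the finite
   type of pairs carries the discrete sigma-algebra. *)
Definition measurable_pairs (N : nat) (VW : nat -> Omega -> 'I_N * 'I_N) : Prop :=
  forall k (A : set ('I_N * 'I_N)), measurable (VW k @^-1` A).

Definition mutually_independent (N : nat) (VW : nat -> Omega -> 'I_N * 'I_N) :
    Prop :=
  forall (J : seq nat) (A : nat -> set ('I_N * 'I_N)), uniq J ->
    P (\bigcap_(j in [set` J]) (VW j @^-1` A j)) =
    (\prod_(j <- J) P (VW j @^-1` A j))%E.

Definition identically_distributed (N : nat) (VW : nat -> Omega -> 'I_N * 'I_N) :
    Prop :=
  forall k l (A : set ('I_N * 'I_N)), P (VW k @^-1` A) = P (VW l @^-1` A).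

Definition edge_law (N : nat) (E : {set {set 'I_N}})
    (VW : nat -> Omega -> 'I_N * 'I_N) : Prop :=
  forall k (v w : 'I_N),
    P [set om | [set (VW k om).1; (VW k om).2]%SET = [set v; w]%SET] =
    (if adj E v w
     then N%:R^-1 * ((deg E v)%:R^-1 + (deg E w)%:R^-1) else 0)%:E.

(* Rectangles form a pi-system generating the sigma-algebra of
   X_0, ..., X_(k-1), VW_0, ..., VW_(k-1). *)
Definition independent_of_past (T : ptopologicalType) (N : nat)
    (X : nat -> Omega -> T) (VW : nat -> Omega -> 'I_N * 'I_N) : Prop :=
  forall k (A : set ('I_N * 'I_N)) (B : nat -> set (borel T))
      (C : nat -> set ('I_N * 'I_N)),
    (forall j, measurable (B j)) ->
    let past := \bigcap_(j in `I_k) (X j @^-1` B j `&` VW j @^-1` C j) in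
    P (VW k @^-1` A `&` past) = (P (VW k @^-1` A) * P past)%E.

End RandomPairs.

(* Main.v *)
(* If m is a midpoint of x and y, comparison with a spherical triangle gives
     cos d(x,z) + cos d(y,z) <= 2 cos (d(x,y)/2) cos d(m,z)
   with distances scaled by sqrt kappa. Hence midpoints are unique, balls of
   radius less than r_kappa are closed under midpoints, and the energy
   sum_(u,v) cos d(X_u,X_v) increases by at least 1 - cos (d/2) when a pair at
   distance d is replaced by its midpoint. The energy is bounded, so the distance
   between the two chosen points tends to 0 along every trajectory. Once it stays
   below eps, a component of n vertices of the graph of the pairs chosen since
   has diameter at most (n - 1) eps; if every edge is chosen infinitely often,
   the diameter of the configuration therefore tends to 0, and since later points
   stay in the balls of radius diam X_K around the points of X_K, the
   configurations converge. By independence almost surely every edge is chosen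
   infinitely often. *)

Require Import Defs.
From HB Require Import structures.
From mathcomp Require Import all_boot all_order all_algebra.
From mathcomp Require Import all_classical all_reals all_analysis.
From mathcomp Require Import zify ring lra.

Set Implicit Arguments.
Unset Strict Implicit.
Unset Printing Implicit Defensive.

Import Order.TTheory GRing.Theory Num.Theory.
Import numFieldNormedType.Exports.

Local Open Scope classical_set_scope.
Local Open Scope ring_scope.

(** * Monotonicity of the cosine on [0, pi] and the spherical triangle inequality *)

Section Trigonometry.
Variable R : realType.
Implicit Types a b c : R.

Lemma cos_le_pi a b : 0 <= a -> a <= b -> b <= pi -> cos b <= cos a.
Proof.
move=> a0 ab bpi; rewrite leNgt ltr_cos ?in_itv/=; lra.
Qed.

Lemma cos_lt_pi a b : 0 <= a -> a < b -> b <= pi -> cos b < cos a.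
Proof. by move=> a0 ab bpi; rewrite ltr_cos// in_itv/=; lra. Qed.

(** The right side minus the left factors as (cos (a - b) - cos c) (cos c - cos (a + b)), with both
    factors nonnegative. This is what makes the third vertex of a comparison triangle exist. *)
Lemma spherical_triangle_ineq a b c : 0 <= a -> 0 <= b ->
  a < pi / 2 -> b < pi / 2 -> c <= a + b -> a <= b + c -> b <= a + c ->
  (cos c - cos a * cos b) ^+ 2 <= (sin a * sin b) ^+ 2.
Proof.
move=> a0 b0 a2 b2 cab abc bac.
have c0 : 0 <= c by lra.
have h1 : cos (a + b) <= cos c by apply: cos_le_pi; lra.
have h2 : cos c <= cos (a - b).
  rewrite -(cos_norm (a - b)); apply: cos_le_pi => //; last by lra.
  by rewrite ler_norml; apply/andP; split; lra.
have ab0 : 0 <= sin a * sin b by rewrite mulr_ge0// sin_ge0_pi; lra.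
rewrite cosD cosB in h1 h2.
by rewrite -subr_ge0 subr_sqr mulr_ge0; lra.
Qed.

End Trigonometry.

(** * Explicit points and great-circle arcs of the model sphere *)

Section Sphere.
Variable R : realType.

Definition vec3 (a b c : R) : 'rV[R]_3 := \row_i [:: a; b; c]`_i.

Lemma dotp_vec3 a b c a' b' c' :
  dotp (vec3 a b c) (vec3 a' b' c') = a * a' + b * b' + c * c'.
Proof. by rewrite /dotp !big_ord_recl big_ord0 !mxE /= addr0 addrA. Qed.

Lemma vec3_unit a b c : a ^+ 2 + b ^+ 2 + c ^+ 2 = 1 ->
  Num.sqrt (dotp (vec3 a b c) (vec3 a b c)) == 1.
Proof. by move=> h; rewrite dotp_vec3 -!expr2 h sqrtr1. Qed.

Definition sphere_point a b c (h : a ^+ 2 + b ^+ 2 + c ^+ 2 = 1) : sphere2 R :=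
  exist _ (vec3 a b c) (vec3_unit h).

Lemma arc_unit (u v t : R) : u ^+ 2 + v ^+ 2 = 1 ->
  cos t ^+ 2 + (sin t * u) ^+ 2 + (sin t * v) ^+ 2 = 1.
Proof. by move=> h; rewrite -addrA !exprMn -mulrDr h mulr1 cos2Dsin2. Qed.

(** The great circle leaving (1, 0, 0) in the direction (0, u, v), with unit speed for
    [model_dist kappa]. *)
Definition arc kappa (u v : R) (h : u ^+ 2 + v ^+ 2 = 1) (t : R) : sphere2 R :=
  sphere_point (arc_unit (Num.sqrt kappa * t) h).

Lemma geodesic_arc (kappa u v : R) (h : u ^+ 2 + v ^+ 2 = 1) (l : R) :
  0 < kappa -> 0 <= l -> Num.sqrt kappa * l <= pi ->
  geodesic (model_dist kappa) (arc kappa h 0) (arc kappa h l) l (arc kappa h).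
Proof.
move=> k0 l0 lpi; split => // t t' /andP[t0 tl] /andP[t'0 t'l].
have s0 : 0 < Num.sqrt kappa by rewrite sqrtr_gt0.
rewrite /model_dist /= dotp_vec3.
set s := Num.sqrt kappa in s0 lpi *.
have -> : cos (s * t) * cos (s * t') + sin (s * t) * u * (sin (s * t') * u) +
    sin (s * t) * v * (sin (s * t') * v) = cos (s * `|t - t'|).
  rewrite -(gtr0_norm s0) -normrM cos_norm mulrBr cosB.
  rewrite -addrA; congr (_ + _); rewrite gtr0_norm// -[RHS]mulr1 -h; ring.
rewrite cosK ?mulKf ?(gt_eqF s0)// in_itv/= mulr_ge0 ?(ltW s0)//=.
by rewrite (le_trans _ lpi)// ler_pM2l// ler_norml; lra.
Qed.

End Sphere.

(** * Comparison inequality for the median of a geodesic triangle *)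

Section CATGeometry.
Variables (R : realType) (kappa : R) (kappa_gt0 : 0 < kappa).
Local Notation s := (Num.sqrt kappa).

Let s_gt0 : 0 < s. Proof. by rewrite sqrtr_gt0. Qed.

Lemma model_dist_eq (x y : sphere2 R) (t : R) : 0 <= t -> s * t <= pi ->
  dotp (val x) (val y) = cos (s * t) -> model_dist kappa x y = t.
Proof.
move=> t0 tpi h; rewrite /model_dist h cosK ?mulKf ?(gt_eqF s_gt0)//.
by rewrite in_itv/= mulr_ge0// (ltW s_gt0).
Qed.

Lemma on_segment_arc (u v : R) (h : u ^+ 2 + v ^+ 2 = 1) (l t : R) :
  0 <= t <= l -> s * l <= pi ->
  on_segment (model_dist kappa) (arc kappa h 0) (arc kappa h l) (arc kappa h t).
Proof.
move=> /andP[t0 tl] lpi; exists l, (arc kappa h), t; split; rewrite ?t0//.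
by apply: geodesic_arc => //; apply: le_trans t0 tl.
Qed.

Lemma geodesic_length (M : metricType R) (x y : M) l c :
  geodesic (@mdist R M) x y l c -> mdist x y = l.
Proof.
move=> [l0 dc <- <-]; rewrite dc ?lexx ?l0// sub0r normrN ger0_norm//.
Qed.

(* Comparison with the spherical triangle p' = (1,0,0), q' = (cos a, sin a, 0),
   r' = (cos b, Y, Z); there the inequality is an equality. *)
Lemma CAT_geodesic_midpoint (M : metricType R) (M_CAT : CAT kappa M)
    (x y z : M) l c :
  geodesic (@mdist R M) x y l c ->
  s * mdist x y < pi / 2 -> s * mdist y z < pi / 2 -> s * mdist x z < pi / 2 ->
  cos (s * mdist x z) + cos (s * mdist y z) <=
    2 * cos (s * mdist x y / 2) * cos (s * mdist (c (l / 2)) z).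
Proof.
move=> gxy.
have lE := geodesic_length gxy; rewrite lE.
have l0 : 0 <= l by rewrite -lE mdist_ge0.
have Dk (u v : M) : s * mdist u v < pi / 2 -> mdist u v < D_ kappa.
  move=> h; rewrite /D_ ltr_pdivlMr// mulrC; apply: (lt_le_trans h).
  have := pi_gt0 R; lra.
set b := mdist x z; set e := mdist y z => l2 e2 b2.
have b0 : 0 <= b by exact: mdist_ge0.
have e0 : 0 <= e by exact: mdist_ge0.
have [ly [cy gyz]] := M_CAT.1 _ _ (Dk y z e2).
have [lx [cx gxz]] := M_CAT.1 _ _ (Dk x z b2).
have lxE := geodesic_length gxz; rewrite -/b in lxE.
have pi0 := pi_gt0 R.
have per : mdist x y + mdist y z + mdist z x < 2 * D_ kappa.
  rewrite (metric_sym z x) lE -/b -/e /D_ mulrA ltr_pdivlMr//.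
  have -> : (l + e + b) * s = s * l + s * e + s * b by ring.
  lra.
have tl : 0 <= l / 2 <= l by lra.
have tb : 0 <= lx <= lx by rewrite -lxE b0 lexx.
(* The second point is the end [z] of the side from [x], so the comparison bounds the median from
   [z]. *)
have cmp := M_CAT.2 x y z _ _ _ _ _ _ gxy gyz gxz per _ _ tl tb.
have cxE : cx lx = z by case: gxz.
rewrite cxE /comparison_inequality in cmp.
have sl0 : 0 <= s * l by rewrite mulr_ge0// (ltW s_gt0).
have sb0 : 0 <= s * b by rewrite mulr_ge0// (ltW s_gt0).
have se0 : 0 <= s * e by rewrite mulr_ge0// (ltW s_gt0).
have tri1 : l <= b + e by rewrite -lE /b /e (metric_sym y z) metric_triangle.
have tri2 : b <= l + e by rewrite -lE metric_triangle.
have tri3 : e <= l + b by rewrite -lE (metric_sym x y) metric_triangle.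
have tri1' : s * l <= s * b + s * e by rewrite -mulrDr ler_pM2l// s_gt0.
have tri2' : s * b <= s * l + s * e by rewrite -mulrDr ler_pM2l// s_gt0.
have tri3' : s * e <= s * l + s * b by rewrite -mulrDr ler_pM2l// s_gt0.
(* The spherical law of cosines determines [Y]. If [sin (s * l)] is 0, division by zero gives
   [Y = 0]; then [s * l = 0] forces [s * e = s * b] and the law still holds. *)
pose Y := (cos (s * e) - cos (s * l) * cos (s * b)) / sin (s * l).
have eE : cos (s * e) = cos (s * l) * cos (s * b) + sin (s * l) * Y.
  rewrite /Y; have [/eqP sl|sl] := eqVneq (sin (s * l)) 0; last by field.
  have l00 : s * l = 0.
    apply/eqP; apply: contraT => ln0.
    suff : 0 < sin (s * l) by rewrite (eqP sl) ltxx.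
    by apply: sin_gt0_pi; rewrite lt_neqAle eq_sym ln0 sl0 /=; lra.
  have -> : s * e = s * b by lra.
  by rewrite l00 sin0 cos0; ring.
have Yb : Y ^+ 2 <= sin (s * b) ^+ 2.
  rewrite /Y; have [/eqP sl|sl] := eqVneq (sin (s * l)) 0.
    by rewrite (eqP sl) invr0 mulr0 expr0n/= sqr_ge0.
  rewrite expr_div_n ler_pdivrMr ?exprn_even_gt0// -exprMn.
  by rewrite [sin (s * b) * _]mulrC; apply: spherical_triangle_ineq; lra.
clearbody Y.
pose Z := Num.sqrt (sin (s * b) ^+ 2 - Y ^+ 2).
have YZ : Y ^+ 2 + Z ^+ 2 = sin (s * b) ^+ 2.
  by rewrite /Z sqr_sqrtr ?subr_ge0//; ring.
clearbody Z.
(* Direction of the arc from p' to r'. If [sin (s * b)] vanishes, so do [Y] and [Z], and any unit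
   vector serves. *)
have [u [v [uv Yu Zv]]] : exists u v, [/\ u ^+ 2 + v ^+ 2 = 1,
    Y = sin (s * b) * u & Z = sin (s * b) * v].
  have [/eqP sb|sb] := eqVneq (sin (s * b)) 0.
    exists 1, 0; rewrite expr1n expr0n/= addr0 (eqP sb) !mul0r.
    move: YZ; rewrite (eqP sb) expr0n/= => /eqP.
    by rewrite paddr_eq0 ?sqr_ge0// !sqrf_eq0 => /andP[/eqP-> /eqP->].
  exists (Y / sin (s * b)), (Z / sin (s * b)); split; try by field.
  by rewrite !expr_div_n -mulrDl YZ divff// expf_neq0.
have uv0 : (1 : R) ^+ 2 + 0 ^+ 2 = 1 by rewrite expr1n expr0n/= addr0.
pose A := arc kappa uv0; pose B := arc kappa uv.
have A0B0 : A 0 = B 0.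
  apply: val_inj; rewrite /= mulr0 sin0 cos0; congr vec3; ring.
have d1 : model_dist kappa (A 0) (A l) = mdist x y.
  rewrite lE; apply: model_dist_eq => //; first by lra.
  by rewrite dotp_vec3 mulr0 sin0 cos0; ring.
have d2 : model_dist kappa (A l) (B b) = mdist y z.
  rewrite -/e; apply: model_dist_eq => //; first by lra.
  by rewrite dotp_vec3 eE Yu; ring.
have d3 : model_dist kappa (A 0) (B b) = mdist x z.
  rewrite -/b; apply: model_dist_eq => //; first by lra.
  by rewrite dotp_vec3 mulr0 sin0 cos0; ring.
have d4 : model_dist kappa (A 0) (A (l / 2)) = mdist x (c (l / 2)).
  have -> : mdist x (c (l / 2)) = l / 2.
    case: gxy => _ dc {1}<- _; rewrite dc ?lexx ?l0//.
    by rewrite sub0r normrN ger0_norm//; lra.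
  apply: model_dist_eq; [lra | rewrite mulrA; lra |].
  by rewrite dotp_vec3 mulr0 sin0 cos0; ring.
have s1 : on_segment (model_dist kappa) (A 0) (A l) (A (l / 2)).
  by apply: on_segment_arc => //; lra.
have s2 : on_segment (model_dist kappa) (A 0) (B b) (B b).
  by rewrite A0B0; apply: on_segment_arc; rewrite ?b0 ?lexx//; lra.
have := cmp (A 0) (A l) (B b) (A (l / 2)) (B b) d1 d2 d3 s1 d4 s2 d3.
set m := mdist _ z; rewrite /model_dist /= dotp_vec3 ler_pdivlMl//.
set w := (X in acos X) => wm.
have cl2 : 0 < cos (s * l / 2) by apply: cos_gt0_pihalf; lra.
have wE : cos (s * b) + cos (s * e) = 2 * cos (s * l / 2) * w.
  have h : s * (l / 2) = s * l / 2 by rewrite mulrA.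
  rewrite /w eE h mulr1 -Yu.
  have {1 2}-> : s * l = (s * l / 2) *+ 2 by rewrite -mulr_natr; field.
  rewrite cos_mulr2n sin_mulr2n; ring.
rewrite wE ler_pM2l ?mulr_gt0//.
(* Needed for [cos (acos w) = w]. It is a Cauchy-Schwarz bound, obtained from the squares of p + q,
   p - q, Y + r and Y - r. *)
have w1 : -1 <= w <= 1.
  have := @cos2Dsin2 R (s * (l / 2)); have := @cos2Dsin2 R (s * b).
  rewrite -YZ /w mulr1 -Yu mulr0 mul0r addr0.
  set p := cos _; set q := cos _; set r := sin _ => h1 h2.
  have := sqr_ge0 (p - q); have := sqr_ge0 (p + q).
  have := sqr_ge0 (Y - r); have := sqr_ge0 (Y + r); have := sqr_ge0 Z.
  rewrite !sqrrD !sqrrN !mulrN; lra.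
have := cos_le_pi _ wm; rewrite acosK ?in_itv//; apply.
  by rewrite mulr_ge0 ?mdist_ge0// (ltW s_gt0).
exact: acos_lepi.
Qed.

End CATGeometry.

(** * Uniqueness of midpoints and midpoint convexity of balls *)

Section Midpoints.
Variables (R : realType) (kappa : R) (kappa_gt0 : 0 < kappa).
Variables (M : metricType R) (M_CAT : CAT kappa M).
Local Notation s := (Num.sqrt kappa).

Let s_gt0 : 0 < s. Proof. by rewrite sqrtr_gt0. Qed.

Lemma scaled_dist_ge0 (x y : M) : 0 <= s * mdist x y.
Proof. by rewrite mulr_ge0 ?mdist_ge0// (ltW s_gt0). Qed.

Lemma is_midpoint_geodesic (x y : M) (l : R) c :
  geodesic (@mdist R M) x y l c -> is_midpoint x y (c (l / 2)).
Proof.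
move=> g; rewrite /is_midpoint (geodesic_length g).
case: g => l0 dc <- <-; rewrite !dc; try lra.
by rewrite sub0r normrN !ger0_norm; lra.
Qed.

Lemma geodesic_exists (x y : M) : s * mdist x y < pi / 2 ->
  exists l c, geodesic (@mdist R M) x y l c.
Proof.
move=> xy; apply: M_CAT.1; rewrite /D_ ltr_pdivlMr// mulrC (lt_trans xy)//.
have := pi_gt0 R; lra.
Qed.

(** Taking [z := m] in [CAT_geodesic_midpoint] gives [1 <= cos (s * mdist (c (l / 2)) m)], so [m] is
    the midpoint of the geodesic and the inequality carries over. *)
Lemma CAT_midpoint (x y z m : M) : is_midpoint x y m ->
  s * mdist x y < pi / 2 -> s * mdist y z < pi / 2 -> s * mdist x z < pi / 2 ->
  cos (s * mdist x z) + cos (s * mdist y z) <=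
    2 * cos (s * mdist x y / 2) * cos (s * mdist m z).
Proof.
move=> [xm ym] xy yz xz; have [l [c g]] := geodesic_exists xy.
suff <- : c (l / 2) = m by apply: CAT_geodesic_midpoint.
have [xc _] := is_midpoint_geodesic g.
have xy0 := scaled_dist_ge0 x y.
have := @CAT_geodesic_midpoint _ _ kappa_gt0 _ M_CAT _ _ m _ _ g.
rewrite ym xm mulrA.
have c0 : 0 < cos (s * mdist x y / 2) by apply: cos_gt0_pihalf; lra.
set p := cos _ in c0 *; set q := cos _ => h.
have q1 : 1 <= q.
  have -> : 1 = (p + p) / (2 * p) by field; rewrite gt_eqF.
  by rewrite ler_pdivrMr ?mulr_gt0// mulrC; apply: h; lra.
apply/mdist_positivity/eqP; apply: contraTT q1; rewrite -ltNge => d0.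
rewrite -(cos0 R) /q ltr_cos ?in_itv/= ?lexx ?pi_ge0 ?scaled_dist_ge0//=.
  by rewrite mulr_gt0// lt_neqAle eq_sym d0 mdist_ge0.
have := metric_triangle (c (l / 2)) x m; rewrite (metric_sym _ x) xc xm => d2.
have : s * mdist (c (l / 2)) m <= s * mdist x y by rewrite ler_pM2l//; lra.
have := pi_gt0 R; lra.
Qed.

Lemma midpointP (x y : M) : s * mdist x y < pi / 2 ->
  is_midpoint x y (midpoint x y).
Proof.
move=> /geodesic_exists[l [c /is_midpoint_geodesic g]].
by apply: (@xgetPex _ x [set m | is_midpoint x y m]); exists (c (l / 2)).
Qed.

Lemma midpointxx (x : M) : midpoint x x = x.
Proof.
have [m0 _] : is_midpoint x x (midpoint x x).
  apply: midpointP; rewrite mdistxx mulr0; have := pi_gt0 R; lra.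
by apply/esym/mdist_positivity; rewrite m0 mdistxx mul0r.
Qed.

(** Let c be the cosine of half the scaled distance from [x] to [y], so that c <= 1. [CAT_midpoint]
    gives cos (s rho) <= c cos (s d(m,z)); if d(m,z) > rho, the right side is less than c cos (s
    rho), a contradiction. *)
Lemma ball_midpoint (x y z : M) (rho : R) : s * rho < pi / 2 ->
  s * mdist x y < pi / 2 -> mdist x z <= rho -> mdist y z <= rho ->
  mdist (midpoint x y) z <= rho.
Proof.
move=> rho2 xy xz yz; have [xm ym] := midpointP xy.
have xz' : s * mdist x z <= s * rho by rewrite ler_pM2l// s_gt0.
have yz' : s * mdist y z <= s * rho by rewrite ler_pM2l// s_gt0.
have xy0 := scaled_dist_ge0 x y; have xz0 := scaled_dist_ge0 x z.
have yz0 := scaled_dist_ge0 y z; have mz0 := scaled_dist_ge0 (midpoint x y) z.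
have h := CAT_midpoint (midpointP xy) xy (le_lt_trans yz' rho2)
  (le_lt_trans xz' rho2).
have hx : cos (s * rho) <= cos (s * mdist x z) by apply: cos_le_pi; lra.
have hy : cos (s * rho) <= cos (s * mdist y z) by apply: cos_le_pi; lra.
rewrite leNgt; apply/negP => rm.
have rm' : s * rho < s * mdist (midpoint x y) z by rewrite ltr_pM2l// s_gt0.
(* The cosine is decreasing only up to pi, so a crude bound through [x] comes first. *)
have mpi : s * mdist (midpoint x y) z <= pi.
  have := metric_triangle (midpoint x y) x z.
  rewrite (metric_sym _ x) xm => d2.
  rewrite -(ler_pM2l s_gt0) in d2; lra.
have : cos (s * mdist (midpoint x y) z) < cos (s * rho).
  by rewrite ltr_cos// in_itv/=; lra.
have r0 : 0 < cos (s * rho) by apply: cos_gt0_pihalf; lra.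
have c0 : 0 < cos (s * mdist x y / 2) by apply: cos_gt0_pihalf; lra.
have c1 := cos_le1 (s * mdist x y / 2).
set u := cos (s * rho) in hx hy r0 *.
set v := cos (s * mdist (midpoint x y) z) in h * => vu.
set c := cos (s * mdist x y / 2) in h c0 c1.
have cv : c * v < c * u by rewrite ltr_pM2l.
have cu : c * u <= u by rewrite ler_piMl// ltW.
lra.
Qed.

End Midpoints.

(** * Effect of one midpoint step on diameter and energy *)

Section Configurations.
Variables (R : realType) (kappa : R) (kappa_gt0 : 0 < kappa).
Variables (M : metricType R) (M_CAT : CAT kappa M).
Variable N : nat.
Local Notation s := (Num.sqrt kappa).
Implicit Types (X : 'rV[M]_N) (e : 'I_N * 'I_N).

Let s_gt0 : 0 < s. Proof. by rewrite sqrtr_gt0. Qed.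

Definition midpoint_step X e : 'rV[M]_N :=
  \row_u if (u == e.1) || (u == e.2)
         then midpoint (X ord0 e.1) (X ord0 e.2) else X ord0 u.

(** Diameter below [r_ kappa], written pairwise and rescaled to suit the cosines. *)
Definition admissible X := forall u v, s * mdist (X ord0 u) (X ord0 v) < pi / 2.

Definition energy X : R := \sum_u \sum_v cos (s * mdist (X ord0 u) (X ord0 v)).

Lemma midpoint_step_ball X e u (z : M) (rho : R) : admissible X ->
  s * rho < pi / 2 ->
  mdist (X ord0 e.1) z <= rho -> mdist (X ord0 e.2) z <= rho ->
  mdist (X ord0 u) z <= rho -> mdist (midpoint_step X e ord0 u) z <= rho.
Proof.
move=> Xa rho2 h1 h2 hu; rewrite mxE; case: ifP => // _.
exact: (ball_midpoint kappa_gt0 M_CAT rho2).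
Qed.

(** Ball convexity is applied to one argument with an old point as centre, then to the other with a
    new one. The predicate [A] covers both the whole vertex set and a single component. *)
Lemma midpoint_step_diam X e (A : pred 'I_N) (rho : R) : admissible X ->
  s * rho < pi / 2 -> A e.1 -> A e.2 ->
  (forall u v, A u -> A v -> mdist (X ord0 u) (X ord0 v) <= rho) ->
  forall u v, A u -> A v ->
    mdist (midpoint_step X e ord0 u) (midpoint_step X e ord0 v) <= rho.
Proof.
move=> Xa rho2 A1 A2 h u v Au Av.
have h' a b : A a -> A b -> mdist (X ord0 a) (midpoint_step X e ord0 b) <= rho.
  by move=> Aa Ab; rewrite metric_sym; apply: midpoint_step_ball => //; exact: h.
by apply: midpoint_step_ball => //; exact: h'.
Qed.

(** A maximum over finitely many pairs keeps the strict inequality, so one closed-ball radius serves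
    all vertices. *)
Lemma admissible_bound X : admissible X ->
  exists2 rho, s * rho < pi / 2 &
    forall u v, mdist (X ord0 u) (X ord0 v) <= rho.
Proof.
move=> Xa; exists (\big[Num.max/0]_u \big[Num.max/0]_v
  mdist (X ord0 u) (X ord0 v)).
  have pi0 : 0 < pi / 2 :> R by rewrite divr_gt0// pi_gt0.
  rewrite mulrC -ltr_pdivlMr//; apply: bigmax_lt; first by rewrite divr_gt0.
  move=> u _; apply: bigmax_lt; first by rewrite divr_gt0.
  by move=> v _; rewrite ltr_pdivlMr// mulrC.
move=> u v.
apply: (le_trans (le_bigmax _ (fun w => mdist (X ord0 u) (X ord0 w)) v)).
exact: (le_bigmax _ (fun t => \big[Num.max/0]_w mdist (X ord0 t) (X ord0 w))).
Qed.

Lemma admissible_midpoint_step X e : admissible X ->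
  admissible (midpoint_step X e).
Proof.
move=> Xa; have [rho rho2 Xrho] := admissible_bound Xa => u v.
rewrite (le_lt_trans _ rho2)// ler_pM2l//.
by apply: (midpoint_step_diam (A := xpredT)) => // a b _ _.
Qed.

Lemma sum_midpoint_step X e (g : M -> R) : e.1 != e.2 ->
  \sum_u g (midpoint_step X e ord0 u) = \sum_u g (X ord0 u) +
    (2 * g (midpoint (X ord0 e.1) (X ord0 e.2))
       - g (X ord0 e.1) - g (X ord0 e.2)).
Proof.
move=> e12; rewrite (bigD1 e.1)//= (bigD1 e.2)/= 1?eq_sym// !mxE !eqxx orbT.
rewrite [in RHS](bigD1 e.1)//= [in RHS](bigD1 e.2)/= 1?eq_sym//.
rewrite (eq_bigr (fun u => g (X ord0 u))); first by ring.
by move=> u /andP[/negbTE u1 /negbTE u2]; rewrite mxE u1 u2.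
Qed.

Lemma midpoint_step_eq X e : e.1 = e.2 -> midpoint_step X e = X.
Proof.
move=> e12; apply/rowP => u; rewrite mxE -e12 (midpointxx kappa_gt0 M_CAT) orbb.
by case: eqP => [->|].
Qed.

(** Replacing the factor cos (d/2) of [CAT_midpoint] by 1 requires a positive cosine at the
    midpoint, which ball convexity provides. *)
Lemma sum_cos_midpoint_step X e (z : M) : admissible X ->
  (forall u, s * mdist (X ord0 u) z < pi / 2) ->
  \sum_u cos (s * mdist (X ord0 u) z) <=
    \sum_u cos (s * mdist (midpoint_step X e ord0 u) z).
Proof.
move=> Xa Xz; have [/midpoint_step_eq->//|e12] := eqVneq e.1 e.2.
rewrite (sum_midpoint_step X (fun x => cos (s * mdist x z)) e12) lerDl.
have mid := midpointP kappa_gt0 M_CAT (Xa e.1 e.2).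
have h := CAT_midpoint kappa_gt0 M_CAT mid (Xa e.1 e.2) (Xz e.2) (Xz e.1).
pose rho := Num.max (mdist (X ord0 e.1) z) (mdist (X ord0 e.2) z).
have rho2 : s * rho < pi / 2 by rewrite /rho /Num.max; case: ifP => _; exact: Xz.
have mz : mdist (midpoint (X ord0 e.1) (X ord0 e.2)) z <= rho.
  by apply: (ball_midpoint kappa_gt0 M_CAT rho2 (Xa e.1 e.2));
    rewrite le_max lexx ?orbT.
rewrite -(ler_pM2l s_gt0) in mz.
have mz0 := scaled_dist_ge0 kappa (midpoint (X ord0 e.1) (X ord0 e.2)) z.
set c := cos (s * mdist (midpoint _ _) z) in h *.
have c0 : 0 < c by apply: cos_gt0_pihalf; lra.
have := cos_le1 (s * mdist (X ord0 e.1) (X ord0 e.2) / 2).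
rewrite -(ler_pM2r c0); lra.
Qed.

(* Passing from X to its successor X' in one argument at a time:
   S(X, X) <= S(X', X) <= S(X', X'). Only the row of X e.1 in the first
   inequality is needed for the gain. *)
Lemma energy_midpoint_step X e : admissible X ->
  energy X + (1 - cos (s * mdist (X ord0 e.1) (X ord0 e.2) / 2)) <=
    energy (midpoint_step X e).
Proof.
move=> Xa; have [e12|e12] := eqVneq e.1 e.2.
  by rewrite midpoint_step_eq// e12 mdistxx mulr0 mul0r cos0 subrr addr0.
have [rho rho2 Xrho] := admissible_bound Xa.
have X'rho u v : mdist (midpoint_step X e ord0 u) (X ord0 v) <= rho.
  exact: midpoint_step_ball.
have X'a u v : s * mdist (X ord0 u) (midpoint_step X e ord0 v) < pi / 2.
  by rewrite (le_lt_trans _ rho2)// ler_pM2l// metric_sym.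
apply: (@le_trans _ _ (\sum_u \sum_v
    cos (s * mdist (midpoint_step X e ord0 v) (X ord0 u)))); last first.
  rewrite exchange_big /=; apply: ler_sum => v _.
  under eq_bigr do rewrite metric_sym.
  rewrite [leRHS](eq_bigr (fun u => cos (s * mdist
    (midpoint_step X e ord0 u) (midpoint_step X e ord0 v)))); last first.
    by move=> u _; rewrite metric_sym.
  exact: sum_cos_midpoint_step.
rewrite /energy (bigD1 e.1)//= [leRHS](bigD1 e.1)//= addrAC.
apply: lerD; last first.
  apply: ler_sum => u _; under eq_bigr do rewrite metric_sym.
  exact: sum_cos_midpoint_step.
rewrite (sum_midpoint_step X (fun x => cos (s * mdist x (X ord0 e.1))) e12).
under eq_bigr do rewrite metric_sym.
rewrite lerD2l.
have [m1 m2] := midpointP kappa_gt0 M_CAT (Xa e.1 e.2).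
rewrite (metric_sym (midpoint _ _)) m1 mdistxx mulr0 cos0.
rewrite (metric_sym (X ord0 e.2)) mulrA.
have := scaled_dist_ge0 kappa (X ord0 e.1) (X ord0 e.2).
have := Xa e.1 e.2; set t := s * mdist _ _ => t2 t0.
have c0 : 0 < cos (t / 2) by apply: cos_gt0_pihalf; lra.
have ct0 : 0 < cos t by apply: cos_gt0_pihalf; lra.
have c1 := cos_le1 (t / 2).
(* With c = cos (t / 2), the row of [e.1] gains 2 c - 1 - cos t = 2 c (1 - c), which is at least 1 -
   c because c >= 1/2. *)
have tE : cos t = cos (t / 2) ^+ 2 *+ 2 - 1.
  by rewrite -cos_mulr2n; congr cos; rewrite -mulr_natr; field.
have c2 : 1 / 2 <= cos (t / 2).
  by rewrite leNgt; apply/negP => c2; move: ct0; rewrite tE; nra.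
rewrite tE; nra.
Qed.

Lemma energy_le X : energy X <= (N * N)%:R.
Proof.
apply: (@le_trans _ _ (\sum_(u < N) \sum_(v < N) 1)).
  by apply: ler_sum => u _; apply: ler_sum => v _; exact: cos_le1.
by rewrite !sumr_const !card_ord -mulrnA.
Qed.

End Configurations.

(** * Vanishing of the diameter along a fixed sequence of pairs *)

Section Trajectories.
Variables (R : realType) (kappa : R) (kappa_gt0 : 0 < kappa).
Variables (M : metricType R) (M_CAT : CAT kappa M).
Variables (N : nat) (X0 : 'rV[M]_N) (X0_adm : admissible kappa X0).
Variable vw : nat -> 'I_N * 'I_N.
Local Notation s := (Num.sqrt kappa).
Local Notation X := (rpm X0 vw).

Let s_gt0 : 0 < s. Proof. by rewrite sqrtr_gt0. Qed.

Lemma rpmS k : X k.+1 = midpoint_step (X k) (vw k.+1).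
Proof. by []. Qed.

Lemma admissible_rpm k : admissible kappa (X k).
Proof.
by elim: k => // k IH; rewrite rpmS; exact: admissible_midpoint_step.
Qed.

Lemma rpm_ball K k (z : M) (rho : R) : s * rho < pi / 2 ->
  (forall u, mdist (X K ord0 u) z <= rho) -> (K <= k)%N ->
  forall u, mdist (X k ord0 u) z <= rho.
Proof.
move=> rho2 h /subnK <-; elim: (k - K)%N => // j IH u; rewrite addSn rpmS.
apply: (midpoint_step_ball kappa_gt0 M_CAT) => //; exact: admissible_rpm.
Qed.

Lemma chosen_dist_cvg0 (eps : R) : 0 < eps -> exists K, forall k, (K <= k)%N ->
  mdist (X k ord0 (vw k.+1).1) (X k ord0 (vw k.+1).2) <= eps.
Proof.
move=> eps0; pose S k := energy kappa (X k).
have Sstep k : S k + (1 - cos (s * mdist (X k ord0 (vw k.+1).1)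
    (X k ord0 (vw k.+1).2) / 2)) <= S k.+1.
  by apply: energy_midpoint_step => //; exact: admissible_rpm.
have Snd : nondecreasing_seq S.
  apply/nondecreasing_seqP => k; apply: le_trans (Sstep k).
  by rewrite lerDl subr_ge0 cos_le1.
have Scvg : cvgn S.
  apply: nondecreasing_is_cvgn => //; exists (N * N)%:R => _ [k _ <-].
  exact: energy_le.
have d0 : (fun k => S k.+1 - S k) @ \oo --> (0 : R).
  rewrite -(subrr (limn S)); apply: cvgB => //.
  by rewrite (cvg_shiftS S).
(* The cap [pi / s] keeps [s * eps' / 2] in the range where the cosine is strictly decreasing. *)
pose eps' := Num.min eps (pi / s).
have eps'0 : 0 < eps' by rewrite lt_min eps0 divr_gt0// pi_gt0.
have eps'pi : s * eps' <= pi.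
  by rewrite mulrC -ler_pdivlMr// ge_min lexx orbT.
have se0 : 0 < s * eps' by rewrite mulr_gt0.
have delta0 : 0 < 1 - cos (s * eps' / 2).
  by have := @cos_lt_pi R 0 (s * eps' / 2); rewrite cos0 subr_gt0; apply; lra.
have /cvgrPdist_lt/(_ _ delta0)[K _ HK] := d0.
exists K => k Kk; apply: (@le_trans _ _ eps'); last by rewrite ge_min lexx.
rewrite leNgt; apply/negP => lt_d.
have := HK k Kk; have := Sstep k.
have := admissible_rpm k (vw k.+1).1 (vw k.+1).2.
rewrite -(ltr_pM2l s_gt0) in lt_d.
move: lt_d; set t := s * mdist _ _ => lt_d t2.
have : cos (t / 2) < cos (s * eps' / 2).
  by apply: cos_lt_pi; lra.
rewrite /= sub0r normrN => ct hS hK; have := ler_norm (S k.+1 - S k); lra.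
Qed.

(* Label of a vertex in the graph whose edges are the pairs chosen at times
   K + 1, ..., K + j. *)
Fixpoint component K j : 'I_N -> 'I_N :=
  if j is i.+1 then fun u =>
    if component K i u == component K i (vw (i + K).+1).1
    then component K i (vw (i + K).+1).2 else component K i u
  else id.

Lemma component_merge K j : component K j.+1 (vw (j + K).+1).1 =
  component K j.+1 (vw (j + K).+1).2.
Proof. by rewrite /= eqxx; case: ifP. Qed.

(** The next label is a function of the current one, so classes never split. *)
Lemma component_mono K i j u v : (i <= j)%N ->
  component K i u = component K i v -> component K j u = component K j v.
Proof.
move=> /subnK <- h; elim: (j - i)%N => // n IH.
by rewrite addSn /= IH.
Qed.

(* Merging components of sizes a and b along an edge of length at most eps
   gives diameter at most (a - 1) eps + eps + (b - 1) eps. *)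
Lemma component_diam K (eps : R) : 0 <= eps -> s * (N%:R * eps) < pi / 2 ->
  (forall k, (K <= k)%N ->
    mdist (X k ord0 (vw k.+1).1) (X k ord0 (vw k.+1).2) <= eps) ->
  forall j u v, component K j u = component K j v ->
    mdist (X (j + K)%N ord0 u) (X (j + K)%N ord0 v) + eps <=
      #|[set x | component K j x == component K j u]%SET|%:R * eps.
Proof.
move=> eps0 epsN heps; elim => [|j IH] u v.
  move=> /= ->; rewrite mdistxx add0r.
  rewrite (_ : [set x | x == v]%SET = [set v]%SET) ?cards1 ?mul1r//.
  by apply/setP => x; rewrite !inE.
pose k := (j + K)%N; pose a := (vw k.+1).1; pose b := (vw k.+1).2.
pose cl x := [set y | component K j y == component K j x]%SET.
pose cl' x := [set y | component K j.+1 y == component K j.+1 x]%SET.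
have hab : mdist (X k ord0 a) (X k ord0 b) <= eps by apply: heps; exact: leq_addl.
have sub x : cl x \subset cl' x.
  apply/fintype.subsetP => y; rewrite !inE => /eqP; move/(component_mono (leqnSn j)).
  by move=> ->.
have le_eps (m n : nat) : (m <= n)%N -> m%:R * eps <= n%:R * eps.
  by move=> mn; rewrite ler_wpM2r// ler_nat.
(* Here [x] and [y] lie in two classes that are just being joined. These are disjoint parts of the
   new class, so their sizes add, and the path x, a, b, y gives the bound. *)
have cross x y : component K j x = component K j a ->
    component K j y = component K j b -> component K j a != component K j b ->
    mdist (X k ord0 x) (X k ord0 y) + eps <= #|cl' x|%:R * eps.
  move=> xa yb ab.
  have := IH x a xa; have := IH b y (esym yb); rewrite -/k -/(cl x) -/(cl b).
  have : (#|cl x| + #|cl b| <= #|cl' x|)%N.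
    rewrite -cardsUI (_ : cl x :&: cl b = finset.set0)%SET; last first.
      apply/setP => z; rewrite !inE xa; apply/negP => /andP[/eqP->].
      by apply/negP.
    rewrite cards0 addn0; apply: subset_leq_card; rewrite finset.subUset sub /=.
    apply: fintype.subset_trans (sub b) _.
    apply/fintype.subsetP => z; rewrite !inE => /eqP->.
    by rewrite /= -/k -/a -/b xa eqxx (eq_sym (component K j b)) (negbTE ab).
  move/le_eps; rewrite natrD mulrDl.
  have := metric_triangle (X k ord0 x) (X k ord0 a) (X k ord0 y).
  have := metric_triangle (X k ord0 a) (X k ord0 b) (X k ord0 y).
  lra.
have merged x y : component K j.+1 x = component K j.+1 y ->
    mdist (X k ord0 x) (X k ord0 y) + eps <= #|cl' x|%:R * eps.
  have [xy _|nxy] := eqVneq (component K j x) (component K j y).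
    exact: le_trans (IH x y xy) (le_eps _ _ (subset_leq_card (sub x))).
  rewrite /= -/k -/a -/b.
  have [xa|nxa] := eqVneq (component K j x) (component K j a);
    have [ya|nya] := eqVneq (component K j y) (component K j a).
  - by move: nxy; rewrite xa ya eqxx.
  - by move=> yb; apply: cross => //; rewrite yb eq_sym.
  - move=> xb; have -> : cl' x = cl' y.
      apply/setP => z; rewrite !inE /= -/k -/a -/b ya eqxx.
      by rewrite (negbTE nxa) xb.
    by rewrite metric_sym; apply: cross => //; rewrite -xb eq_sym.
  - by move=> /eqP; rewrite (negbTE nxy).
move=> uv; rewrite addSn rpmS -/k -/(cl' u).
(* A class without the chosen pair does not move; for the class containing it, [midpoint_step_diam]
   preserves the bound. *)
have [ua|nua] := eqVneq (component K j.+1 u) (component K j.+1 a); last first.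
  have out x : component K j.+1 x = component K j.+1 u ->
      midpoint_step (X k) (vw k.+1) ord0 x = X k ord0 x.
    move=> xu; rewrite mxE; case: ifP => // /orP[] /eqP xe.
      by move: nua; rewrite -xu xe eqxx.
    by move: nua; rewrite -xu xe (component_merge K j) eqxx.
  by rewrite !out//; exact: merged.
rewrite -lerBrDr.
apply: (midpoint_step_diam kappa_gt0 M_CAT
    (A := fun x => component K j.+1 x == component K j.+1 u)).
- exact: admissible_rpm.
- apply: le_lt_trans epsN; rewrite ler_pM2l//.
  have : (#|cl' u| <= N)%N by rewrite -[leqRHS]card_ord max_card.
  move/le_eps; lra.
- exact/eqP/esym.
- by apply/eqP/esym; rewrite ua; exact: component_merge.
- move=> x y /eqP xu /eqP yu; rewrite lerBrDr.
  have -> : cl' u = cl' x by apply/setP => z; rewrite !inE xu.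
  by apply: merged; rewrite xu.
- exact/eqP.
- exact/eqP.
Qed.

Lemma rpm_diam_cvg0 (E : {set {set 'I_N}}) : connected_graph E ->
  (forall v w, adj E v w -> forall K, exists2 k, (K < k)%N &
     [set (vw k).1; (vw k).2]%SET = [set v; w]%SET) ->
  forall eps : R, 0 < eps -> exists K, forall k, (K <= k)%N ->
    forall u v, mdist (X k ord0 u) (X k ord0 v) <= eps.
Proof.
move=> Econn Eio eps eps0.
have [N0|N0] := posnP N.
  by exists 0%N => k _ u; have := ltn_ord u; rewrite {2}N0.
have NR : 0 < N%:R :> R by rewrite ltr0n.
have pi0 := pi_gt0 R.
(* A class has at most [N] vertices, so [N%:R * eta] will bound the diameter; the cap [pi / s / 4]
   keeps this radius below [r_ kappa]. *)
pose eta := Num.min eps (pi / s / 4) / N%:R.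
have eta0 : 0 < eta by rewrite divr_gt0// lt_min eps0 !divr_gt0.
have etaE : N%:R * eta = Num.min eps (pi / s / 4) by rewrite mulrC divfK ?gt_eqF.
have eta2 : s * (N%:R * eta) < pi / 2.
  rewrite etaE; apply: (@le_lt_trans _ _ (s * (pi / s / 4))).
    by rewrite ler_pM2l// ge_min lexx orbT.
  have -> : s * (pi / s / 4) = pi / 4 by field; rewrite gt_eqF.
  lra.
have [K HK] := chosen_dist_cvg0 eta0.
have hc v w : adj E v w -> exists j, component K j v = component K j w.
  move=> /Eio /(_ K)[k Kk vwE]; exists (k - K)%N.
  (* Stage j of the labelling corresponds to time [j + K], so the pair of time [k] is merged in
     passing from stage [k.-1 - K] to stage [k - K]. *)
  have kE : k = (k.-1 - K + K).+1 by lia.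
  have -> : (k - K = (k.-1 - K).+1)%N by lia.
  have := component_merge K (k.-1 - K); rewrite -kE.
  have : v \in [set (vw k).1; (vw k).2]%SET by rewrite vwE !inE eqxx.
  have : w \in [set (vw k).1; (vw k).2]%SET by rewrite vwE !inE eqxx orbT.
  have : (vw k).1 \in [set v; w]%SET by rewrite -vwE !inE eqxx.
  have : (vw k).2 \in [set v; w]%SET by rewrite -vwE !inE eqxx orbT.
  rewrite !inE.
  by do 4 (case/orP => /eqP ?); congruence.
have hconn v w : exists j, component K j v == component K j w.
  have /connectP[p] := Econn v w.
  elim: p v => [|x p IH] v /=; first by move=> _ ->; exists 0%N; apply/eqP.
  move=> /andP[vx xp] wE; have [i hi] := hc v x vx; have [j /eqP hj] := IH x xp wE.
  exists (maxn i j); apply/eqP; rewrite (component_mono (leq_maxl i j) hi).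
  exact: component_mono (leq_maxr i j) hj.
pose J v w := xchoose (hconn v w).
pose j := (\max_v \max_w J v w)%N.
have hj v w : component K j v = component K j w.
  apply: (component_mono _ (eqP (xchooseP (hconn v w)))).
  apply: leq_trans (@leq_bigmax _ (fun w => J v w) w) _.
  exact: (@leq_bigmax _ (fun v => \max_w J v w)%N).
have diamj u v : mdist (X (j + K)%N ord0 u) (X (j + K)%N ord0 v) <= N%:R * eta.
  have := component_diam (ltW eta0) eta2 HK (hj u v).
  have : (#|[set x | component K j x == component K j u]%SET| <= N)%N.
    by rewrite -[leqRHS]card_ord max_card.
  rewrite -(ler_nat R) -(ler_pM2r eta0); lra.
(* Ball confinement from time [j + K] on, used once in each argument, preserves the bound at later
   times. *)
exists (j + K)%N => k jk u v; apply: (@le_trans _ _ (N%:R * eta)).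
  apply: (rpm_ball eta2 _ jk) => u'; rewrite metric_sym.
  by apply: (rpm_ball eta2 _ jk).
by rewrite etaE ge_min lexx.
Qed.

End Trajectories.

(** * Convergence of all vertices to a common limit *)

Section Limits.

Lemma cvg_row (T : Type) (F : set_system T) (FF : Filter F)
    (M : topologicalType) (N : nat) (f : T -> 'rV[M]_N) (Y : 'rV[M]_N) :
  (forall u, (fun t => f t ord0 u) @ F --> Y ord0 u) -> f @ F --> Y.
Proof.
move=> fY A [B nB BA]; rewrite /fmap/= /nbhs/=.
have : \forall t \near F, forall u, B ord0 u (f t ord0 u).
  by apply: filter_forall => u; exact: fY.
by apply: filterS => t Bt; apply: BA => i j; rewrite ord1.
Qed.

Lemma continuous_const_row (M : topologicalType) (N : nat) :
  continuous (fun x : M => const_mx x : 'rV[M]_N).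
Proof.
move=> x; apply: cvg_row => u; rewrite mxE.
rewrite (_ : (fun t => _) = id); first exact: cvg_id.
by apply/funext => t; rewrite mxE.
Qed.

(** Confinement to small balls makes the trajectory of [u0] Cauchy; completeness gives its limit,
    and the vanishing diameter transfers it to the other vertices. *)
Lemma rpm_cvg (R : realType) (kappa : R) (M : completeMetricType R) (N : nat)
    (X0 : 'rV[M]_N) (vw : nat -> 'I_N * 'I_N) (E : {set {set 'I_N}}) (u0 : 'I_N) :
  0 < kappa -> CAT kappa M -> admissible kappa X0 -> connected_graph E ->
  (forall v w, adj E v w -> forall K, exists2 k, (K < k)%N &
     [set (vw k).1; (vw k).2]%SET = [set v; w]%SET) ->
  exists x : M, forall u, (fun k => rpm X0 vw k ord0 u) @ \oo --> x.
Proof.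
move=> k0 M_CAT X0a Econn Eio.
have s0 : 0 < Num.sqrt kappa by rewrite sqrtr_gt0.
have pi0 := pi_gt0 R.
have diam0 := rpm_diam_cvg0 k0 M_CAT X0a Econn Eio.
have near_u0 (eps : R) : 0 < eps -> exists K, forall k u, (K <= k)%N ->
    mdist (rpm X0 vw k ord0 u) (rpm X0 vw K ord0 u0) < eps.
  move=> eps0; pose eta := Num.min (eps / 2) (pi / Num.sqrt kappa / 4).
  have eta0 : 0 < eta by rewrite lt_min !divr_gt0.
  have [K HK] := diam0 _ eta0; exists K => k u Kk.
  apply: (@le_lt_trans _ _ eta); last first.
    by rewrite gt_min ltr_pdivrMr// ltr_pMr// ltr1n.
  apply: (rpm_ball k0 M_CAT X0a _ _ Kk) => [|u']; last exact: HK.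
  apply: (@le_lt_trans _ _ (Num.sqrt kappa * (pi / Num.sqrt kappa / 4))).
    by rewrite ler_pM2l// ge_min lexx orbT.
  have -> : Num.sqrt kappa * (pi / Num.sqrt kappa / 4) = pi / 4.
    by field; rewrite gt_eqF.
  lra.
pose f k := rpm X0 vw k ord0 u0.
have : cvgn f.
  apply: cauchy_cvg; apply: cauchy_exP => eps eps0.
  have [K HK] := near_u0 _ eps0; exists (f K).
  exists K => // k Kk; rewrite ballEmdist/= metric_sym; exact: HK.
move=> fl; exists (limn f) => u; apply/metricType_numDomainType.cvgrPdist_le => eps eps0.
have eps2 : 0 < eps / 2 by rewrite divr_gt0.
have [K HK] := diam0 _ eps2.
have /metricType_numDomainType.cvgrPdist_le/(_ _ eps2)[K' _ HK'] := fl.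
exists (maxn K K') => // k; rewrite /= geq_max => /andP[Kk K'k].
have := HK k Kk u0 u; have := HK' k K'k; rewrite /= -/(f k).
have := metric_triangle (limn f) (f k) (rpm X0 vw k ord0 u); lra.
Qed.

End Limits.

(** * Measurability of the iterates and of their limit *)

Section Measurability.
Context (d : measure_display) (Omega : measurableType d) (R : realType).

(** The configuration at time [k] depends on finitely many pairs, each with finitely many values, so
    any [B] is allowed. This generality lets the induction pull [B] back along [midpoint_step]. *)
Lemma measurable_rpm (M : metricType R) (N : nat)
    (VW : nat -> Omega -> 'I_N * 'I_N) (X0 : 'rV[M]_N) :
  measurable_pairs VW -> forall k (B : set 'rV[M]_N),
    measurable [set om | B (rpm X0 (VW^~ om) k)].
Proof.
move=> VWm; elim => [|k IH] B.
  have [BX|BX] := pselect (B X0).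
    by rewrite (_ : [set _ | _] = setT)//; apply/seteqP; split.
  by rewrite (_ : [set _ | _] = set0)//; apply/seteqP; split.
rewrite (_ : [set _ | _] = \bigcup_(e in [set: 'I_N * 'I_N])
    (VW k.+1 @^-1` [set e] `&`
     [set om | B (midpoint_step (rpm X0 (VW^~ om) k) e)])).
  apply: fin_bigcup_measurable; first exact: finite_finset.
  move=> e _; apply: measurableI; first exact: VWm.
  exact: (IH (fun X => B (midpoint_step X e))).
apply/seteqP; split => [om Bom|om [e _ [/= <-]]//].
by exists (VW k.+1 om).
Qed.

(** On [G] the limit lies in [V] exactly when, for some m, the balls of radius 1/(m + 1) about [f k]
    eventually lie in [V]: a countable combination of measurable events. *)
Lemma measurable_lim_preimage (M : metricType R) (f : nat -> Omega -> M)
    (g : Omega -> M) (G : set Omega) (V : set M) : measurable G ->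
  (forall k (B : set M), measurable (f k @^-1` B)) ->
  (forall om, G om -> f ^~ om @ \oo --> g om) ->
  open V -> measurable (G `&` g @^-1` V).
Proof.
move=> Gm fm fg oV.
rewrite (_ : _ `&` _ = G `&` \bigcup_m \bigcup_K \bigcap_(k in [set k | (K <= k)%N])
    (f k @^-1` [set x | ball x m.+1%:R^-1 `<=` V])).
  apply: measurableI => //; apply: bigcup_measurable => m _.
  apply: bigcup_measurable => K _; apply: bigcap_measurable => //.
  by exists K => /=.
apply/seteqP; split => om [Gom].
  move=> /= Vg; split => //.
  have := open_nbhs_nbhs (conj oV Vg); rewrite -nbhs_ballE => -[e /= e0 eV].
  have e20 : 0 < e / 2 by rewrite divr_gt0.
  have [m _ Hm] := near_infty_natSinv_lt (PosNum e20).
  have /metricType_numDomainType.cvgrPdist_lt/(_ _ e20)[K _ HK] := fg om Gom.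
  exists m => //; exists K => // k Kk y; rewrite ballEmdist /= => fy.
  apply: eV; rewrite ballEmdist /=.
  have /= gf := HK k Kk; have {}fy := lt_trans fy (Hm m (leqnn m)).
  rewrite /= in fy; have := metric_triangle (g om) (f k om) y; lra.
move=> [m _ [K _ HK]]; split => //.
have m0 : 0 < m.+1%:R^-1 :> R by rewrite invr_gt0.
have /metricType_numDomainType.cvgrPdist_lt/(_ _ m0)[K' _ HK'] := fg om Gom.
apply: (HK (maxn K K') (leq_maxl _ _)); rewrite ballEmdist /= metric_sym.
exact: (HK' _ (leq_maxr _ _)).
Qed.

End Measurability.

(** * Almost sure recurrence in an independent sequence *)

Section BorelCantelli.
Context (d : measure_display) (Omega : measurableType d) (R : realType).
Variables (P : probability Omega R) (N : nat).
Variable VW : nat -> Omega -> 'I_N * 'I_N.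

(** By independence, missing [B] at the times K + 1 through K + n has probability (1 - p)^n, which
    tends to 0. So missing it forever after K is a null event, and the countably many K are
    combined. *)
Lemma ae_infinitely_often (B : set ('I_N * 'I_N)) (p : R) : 0 < p ->
  measurable_pairs VW -> mutually_independent P VW ->
  (forall k, P (VW k @^-1` B) = p%:E) ->
  {ae P, forall om, forall K, exists2 k, (K < k)%N & B (VW k om)}.
Proof.
move=> p0 VWm VWi PB; apply/ae_foralln => K.
pose Q n := \bigcap_(j in [set` iota K.+1 n]) (VW j @^-1` (~` B)).
have p1 : p <= 1 by rewrite -lee_fin -(PB 0%N) probability_le1.
have PQ n : P (Q n) = ((1 - p) ^+ n)%:E.
  rewrite /Q VWi ?iota_uniq//.
  rewrite (eq_bigr (fun=> (1 - p)%:E)); last first.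
    move=> k _; rewrite -preimage_setC probability_setC; last exact: VWm.
    by rewrite PB EFinB.
  by rewrite prodEFin big_const_seq count_predT size_iota iter_mulr_1.
pose Z := \bigcap_(j in [set j | (K < j)%N]) (VW j @^-1` (~` B)).
have Zm : measurable Z.
  by apply: bigcap_measurable => [|k _]; [exists K.+1 => /= | exact: VWm].
exists Z; split => //; last first.
  move=> om /= nex j Kj Bj; apply: nex; by exists j.
apply/eqP; rewrite eq_le measure_ge0 andbT; apply/lee_addgt0Pr => e e0.
have p1' : `|1 - p| < 1 by rewrite ger0_norm; lra.
have /cvgrPdist_lt/(_ _ e0)[n _ Hn] := cvg_expr p1'.
have := Hn n (leqnn n); rewrite /= sub0r normrN => /ltW hn.
apply: (@le_trans _ _ (P (Q n))).
  apply: le_measure; rewrite ?inE//.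
    (* [bigcap_measurable] asks for a nonempty index set, so n = 0 is treated apart. *)
    have [->|n0] := posnP n.
      by rewrite (_ : Q 0%N = setT)//; apply/seteqP; split.
    apply: bigcap_measurable; last by move=> k _; exact: VWm.
    by exists K.+1; rewrite /= mem_iota leqnn /=; lia.
  by move=> om Zom j; rewrite /= mem_iota => /andP[Kj _]; exact: Zom.
by rewrite PQ add0e lee_fin (le_trans _ hn)// ler_norm.
Qed.

End BorelCantelli.

Theorem theorem3 (R : realType) (kappa : R) (kappa_gt0 : 0 < kappa)
    (N : nat) (N_ge2 : (2 <= N)%N) (E : {set {set 'I_N}})
    (E_simple : simple_graph E) (E_connected : connected_graph E)
    (M : completeMetricType R) (M_CAT : CAT kappa M)
    (X0 : 'rV[M]_N)
    (X0_diam : (diam [set X0 ord0 v | v in [set: 'I_N]] < (r_ kappa)%:E)%E)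
    (d : measure_display) (Omega : measurableType d) (P : probability Omega R)
    (VW : nat -> Omega -> 'I_N * 'I_N)
    (VW_meas : measurable_pairs VW)
    (VW_indep : mutually_independent P VW)
    (VW_ident : identically_distributed P VW)
    (VW_law : edge_law P E VW)
    (X : nat -> Omega -> 'rV[M]_N)
    (X_rpm : forall k om, X k om = rpm X0 (fun j => VW j om) k)
    (VW_past : independent_of_past P X VW) :
  exists Xoo : {RV P >-> borel 'rV[M]_N},
    (forall om, consensus (Xoo om : 'rV[M]_N)) /\
    {ae P, forall om, (fun k => X k om) @ \oo --> (Xoo om : 'rV[M]_N)}.
Proof.
pose u0 : 'I_N := Ordinal (ltn_trans (ltnSn 0) N_ge2).
have s0 : 0 < Num.sqrt kappa by rewrite sqrtr_gt0.
have X0a : admissible kappa X0.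
  move=> u v; rewrite mulrC -ltr_pdivlMr// -mulrA -invfM -lte_fin.
  apply: le_lt_trans X0_diam; apply: ereal_sup_ubound.
  by exists (X0 ord0 u); [exists u | exists (X0 ord0 v) => //; exists v].
have io : {ae P, forall om (e : 'I_N * 'I_N), adj E e.1 e.2 ->
    forall K, exists2 k, (K < k)%N &
    [set (VW k om).1; (VW k om).2]%SET = [set e.1; e.2]%SET}.
  (* There are finitely many pairs, so the almost sure statements for each of them combine. *)
  apply: filter_forall => -[v w] /=.
  have [vw|nvw] := boolP (adj E v w); last by apply: aeW.
  have degv : 0 < (deg E v)%:R :> R.
    by rewrite ltr0n card_gt0; apply/finset.set0Pn; exists w; rewrite inE.
  have p0 : 0 < N%:R^-1 * ((deg E v)%:R^-1 + (deg E w)%:R^-1) :> R.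
    rewrite mulr_gt0 ?invr_gt0 ?ltr0n ?(ltn_trans _ N_ge2)//.
    by rewrite ltr_wpDr ?invr_ge0 ?invr_gt0.
  have := @ae_infinitely_often _ _ _ P _ VW
    [set e | [set e.1; e.2]%SET = [set v; w]%SET] _ p0 VW_meas VW_indep.
  have PB k := VW_law k v w; rewrite vw in PB => /(_ PB).
  by apply: filterS => om h _; exact: h.
have [Z [Zm PZ0 nioZ]] := io.
(* The premise [~ Z om] stands under the existential so that a point can be chosen at every
   outcome. *)
have lim_ex om : exists x : M, ~ Z om ->
    forall u, (fun k => X k om ord0 u) @ \oo --> x.
  have [Zom|nZom] := pselect (Z om); first by exists (X0 ord0 u0).
  have iom : forall v w, adj E v w -> forall K, exists2 k, (K < k)%N &
      [set (VW k om).1; (VW k om).2]%SET = [set v; w]%SET.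
    have [h|nh] := pselect (forall e : 'I_N * 'I_N, adj E e.1 e.2 ->
      forall K, exists2 k, (K < k)%N &
      [set (VW k om).1; (VW k om).2]%SET = [set e.1; e.2]%SET).
      by move=> v w; exact: (h (v, w)).
    by exfalso; apply/nZom/nioZ.
  have [x hx] := rpm_cvg u0 kappa_gt0 M_CAT X0a E_connected iom.
  exists x => _ u; rewrite (_ : (fun k => _) = fun k => rpm X0 (VW^~ om) k ord0 u)//.
  by apply/funext => k; rewrite X_rpm.
(* A constant value on the null set [Z] makes [x] measurable there, whatever the choice
   elsewhere. *)
pose x om := if `[< Z om >] then X0 ord0 u0 else projT1 (cid (lim_ex om)).
have xP om : ~ Z om -> forall u, (fun k => X k om ord0 u) @ \oo --> x om.
  by move=> nZ; rewrite /x asboolF//; exact: (projT2 (cid (lim_ex om))).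
pose Y om : borel 'rV[M]_N := (const_mx (x om) : 'rV[M]_N).
have Ym : measurable_fun [set: Omega] Y.
  apply: (@measurability _ _ _ (borel 'rV[M]_N) _ _ (@open 'rV[M]_N)) => //.
  move=> _ [U oU <-]; rewrite setTI.
  (* The diagonal embedding of [M] is continuous, so measurability of [Y] reduces to that of the
     [M]-valued limit [x], treated separately on [Z] and off it. *)
  pose V := [set y : M | U (const_mx y : 'rV[M]_N)].
  have oV : open V.
    apply: (open_comp (f := fun y : M => const_mx y : 'rV[M]_N)) => //.
    by move=> y _; exact: continuous_const_row.
  rewrite -(setTI (Y @^-1` U)) -(setUCl Z) setIUl; apply: measurableU.
    apply: (measurable_lim_preimage (f := fun k om => X k om ord0 u0) (g := x)
      (V := V)) => //; first exact: measurableC.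
      move=> k B; rewrite (_ : _ @^-1` B = [set om |
        [set C : 'rV[M]_N | B (C ord0 u0)] (rpm X0 (VW^~ om) k)]).
        exact: measurable_rpm.
      by apply/funext => om /=; rewrite X_rpm.
    by move=> om nZ; exact: xP.
  have [UX|UX] := pselect (U (const_mx (X0 ord0 u0))).
    rewrite (_ : Z `&` _ = Z)//; apply/seteqP; split => [om []//|om Zom].
    by split => //; rewrite /Y/preimage/= /x asboolT.
  rewrite (_ : Z `&` _ = set0)//; apply/seteqP; split => // om [Zom].
  by rewrite /Y/preimage/= /x asboolT.
exists (mfun_Sub (mem_set Ym)); split; first by move=> om; exists (x om).
exists Z; split => // om /= nc; apply: contrapT => nZ; apply: nc.
apply: cvg_row => u; rewrite mxE; exact: xP.
Qed.
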